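(* Let $r: G \rightarrow H$ be a group retraction, where $G$ is a finite group of order $n$. Then there exists a connected finite topological space $X_r$ of height $1$ and a topological retraction $\overline{r}: X_r \rightarrow X_r$ that realizes $r$ in both the topological category $\mathbf{Top}$ and the homotopical category $\mathbf{HTop}$.
   Context: In a category, an object $A$ is a retract of an object $B$ if there are morphisms $r: B\to A$ and $i: A\to B$ with $r\circ i=\mathrm{id}_A$; the morphism $r$ is then called a retraction of $B$ onto $A$. This notion is used in the category of groups (group retractions), in the category $\mathbf{Top}$ of topological spaces (topological retractions), and in the homotopy category $\mathbf{HTop}$ of topological spaces. A topological retraction written $\overline{r}: X_r\to X_r$ is a continuous map that is the identity on its image $\overline{r}(X_r)$; it is regarded as a retraction of $X_r$ onto $Y=\overline{r}(X_r)$, with $\overline{i}: Y\to X_r$ the inclusion. For a topological space $X$, $\mathrm{Aut}(X)$ is its group of automorphisms (self-homeomorphisms) and $\mathcal{E}(X)$ is its group of self-homotopy equivalences (homotopy classes of homotopy equivalences $X\to X$, under composition). Finite topological spaces are assumed to be $T_0$ and are identified with finite posets: for $x\in X$, $U_x$ is the intersection of all open sets containing $x$, and $x\leq y$ if and only if $U_x\subseteq U_y$. Continuous maps are then exactly the order-preserving maps. The height of a finite poset is one less than the maximum number of elements in a chain. Realization: let $\overline{r}: X\to Y$ be a retraction in $\mathbf{Top}$ (or $\mathbf{HTop}$), with $\overline{i}: Y\to X$ a morphism such that $\overline{r}\circ\overline{i}=\mathrm{id}_Y$. The associated natural map $\overline{r}':\mathrm{Aut}(X)\to\mathrm{Aut}(Y)$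 (or $\overline{r}':\mathcal{E}(X)\to\mathcal{E}(Y)$) is defined by $\overline{r}'(f)=\overline{r}\circ f\circ\overline{i}$ for every $f\in\mathrm{Aut}(X)$ (or $f\in\mathcal{E}(X)$), provided that the restriction $f|_{\overline{i}(Y)}$ belongs to $\mathrm{Aut}(\overline{i}(Y))$ (or to $\mathcal{E}(\overline{i}(Y))$). A group retraction $r: G\to H$ is realized by $\overline{r}$ in $\mathbf{Top}$ (or $\mathbf{HTop}$) if $\overline{r}: X\to Y$ is a topological retraction satisfying these conditions and $r=\overline{r}'$, where the equality is understood under isomorphisms $\mathrm{Aut}(X)\cong G$ and $\mathrm{Aut}(Y)\cong H$ (or $\mathcal{E}(X)\cong G$ and $\mathcal{E}(Y)\cong H$). *)

(* Defs.v *)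
From HB Require Import structures.
From mathcomp Require Import all_boot all_order all_algebra finmap.
From mathcomp Require Import all_classical all_reals all_analysis.

Set Implicit Arguments.
Unset Strict Implicit.
Unset Printing Implicit Defensive.

Import Order.TTheory GRing.Theory Num.Theory.
Import numFieldTopology.Exports numFieldNormedType.Exports.

Local Open Scope classical_set_scope.
Local Open Scope quotient_scope.
Local Open Scope ring_scope.

Record category := Category {
  obj :> Type;
  hom : obj -> obj -> Type;
  idm : forall X, hom X X;
  compm : forall X Y Z, hom Y Z -> hom X Y -> hom X Z;
  compmA : forall X Y Z T (h : hom Z T) (g : hom Y Z) (f : hom X Y),
    compm h (compm g f) = compm (compm h g) f;
  comp1m : forall X Y (f : hom X Y), compm (idm Y) f = f;
  compm1 : forall X Y (f : hom X Y), compm f (idm X) = f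
}.

Declare Scope cat_scope.
Delimit Scope cat_scope with cat.
Notation "g \c f" := (compm g f) (at level 50, left associativity) : cat_scope.
Local Open Scope cat_scope.

Record aut (C : category) (X : C) := Aut {
  autm : hom X X;
  autm_inv : hom X X;
  autmK : autm_inv \c autm = idm X;
  autmVK : autm \c autm_inv = idm X
}.

Section AutGroup.
Context (C : category) (X : C).
Implicit Types f g h : aut X.

Lemma autm_inj f g : autm f = autm g -> f = g.
Proof.
case: f g => [f f' f'f ff'] [g g' g'g gg'] /= fg; subst g.
have e : f' = g' by rewrite -(compm1 f') -gg' compmA f'f comp1m.
subst g'; congr Aut; exact: Prop_irrelevance.
Qed.

HB.instance Definition _ := gen_eqMixin (aut X).
HB.instance Definition _ := gen_choiceMixin (aut X).

Definition aut1 : aut X := Aut (comp1m (idm X)) (comp1m (idm X)).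

Definition autV f : aut X := Aut (autmVK f) (autmK f).

Lemma autMK f g :
  (autm_inv g \c autm_inv f) \c (autm f \c autm g) = idm X.
Proof. by rewrite compmA -(compmA (autm_inv g)) autmK compm1 autmK. Qed.

Lemma autMVK f g :
  (autm f \c autm g) \c (autm_inv g \c autm_inv f) = idm X.
Proof. by rewrite compmA -(compmA (autm f)) autmVK compm1 autmVK. Qed.

Definition autM f g : aut X := Aut (autMK f g) (autMVK f g).

Lemma autMA : associative autM.
Proof. by move=> f g h; apply: autm_inj; rewrite /= compmA. Qed.

Lemma aut1M : left_id aut1 autM.
Proof. by move=> f; apply: autm_inj; rewrite /= comp1m. Qed.

Lemma autM1 : right_id aut1 autM.
Proof. by move=> f; apply: autm_inj; rewrite /= compm1. Qed.

Lemma autMV : left_inverse aut1 autV autM.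
Proof. by move=> f; apply: autm_inj; rewrite /= autmK. Qed.

Lemma autMVr : right_inverse aut1 autV autM.
Proof. by move=> f; apply: autm_inj; rewrite /= autmVK. Qed.

HB.instance Definition _ := isGroup.Build (aut X) autMA aut1M autM1 autMV autMVr.

End AutGroup.

Definition group_retraction (G H : groupType) (r : {multiplicative G -> H}) :=
  exists i : {multiplicative H -> G}, cancel i r.

(* "f restricted to i(Y) is an automorphism of i(Y)", with Y identified with
   i(Y) through i. In a homotopy category i(Y) is not a subset of X, so the
   restriction has to be read as the composite of f with i. *)
Definition restricts_to_aut (C : category) (X Y : C) (i : hom Y X) (f : aut X) :=
  exists g : aut Y, autm f \c i = i \c autm g.

(* rb' is the natural map f |-> rb o f o ib; it is well defined and unique by the
   first two clauses and autm_inj. *)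
Definition realizes (C : category) (X Y : C) (rb : hom X Y) (ib : hom Y X)
    (G H : groupType) (r : G -> H) :=
  [/\ rb \c ib = idm Y,
      forall f : aut X, restricts_to_aut ib f &
      exists rb' : aut X -> aut Y,
        (forall f, autm (rb' f) = (rb \c autm f) \c ib) /\
        exists (phi : {multiplicative aut X -> G})
               (psi : {multiplicative aut Y -> H}),
          [/\ bijective phi, bijective psi &
              forall f, r (phi f) = psi (rb' f)]].

Section Top.
Implicit Types X Y Z T : topologicalType.

Definition ctsid X : continuousType X X := idfun.

Definition ctscomp X Y Z (g : continuousType Y Z) (f : continuousType X Y) :
  continuousType X Z := g \o f.

Lemma ctscompA X Y Z T (h : continuousType Z T) (g : continuousType Y Z)
    (f : continuousType X Y) :
  ctscomp h (ctscomp g f) = ctscomp (ctscomp h g) f.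
Proof. exact/continuousEP. Qed.

Lemma ctscomp1f X Y (f : continuousType X Y) : ctscomp (ctsid Y) f = f.
Proof. exact/continuousEP. Qed.

Lemma ctscompf1 X Y (f : continuousType X Y) : ctscomp f (ctsid X) = f.
Proof. exact/continuousEP. Qed.

End Top.

Definition Top : category := Category ctscompA ctscomp1f ctscompf1.

Section Homotopy.
Context (R : realType).
Implicit Types X Y Z T : topologicalType.

(* The values of F outside X x [0, 1] are irrelevant. *)
Definition homotopic X Y (f g : X -> Y) :=
  exists F : X * R -> Y,
    [/\ {within [set: X] `*` `[0, 1], continuous F},
        forall x, F (x, 0) = f x & forall x, F (x, 1) = g x].

Lemma within_continuous_comp X Y Z (A : set X) (B : set Y) (p : X -> Y)
    (F : Y -> Z) :
  continuous p -> (forall x, A x -> B (p x)) ->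
  {within B, continuous F} -> {within A, continuous (F \o p)}.
Proof.
move=> cp pAB /subspace_continuousP cF; apply/subspace_continuousP => x Ax.
move=> U UFpx; have /(_ U UFpx) FU := cF _ (pAB _ Ax).
have /(_ _ FU) := cp x.
by apply: (@filterS _ (nbhs x)) => z /= BU /pAB.
Qed.

Lemma homotopic_refl X Y (f : X -> Y) : continuous f -> homotopic f f.
Proof.
move=> cf; exists (f \o fst); split => //.
by apply: continuous_subspaceT => z; apply: continuous_comp; [exact: cvg_fst|exact: cf].
Qed.

Lemma continuous_mkpair X Y Z (f : X -> Y) (g : X -> Z) :
  continuous f -> continuous g -> continuous (fun x => (f x, g x)).
Proof.
move=> cf cg x.
exact: (@cvg_pair _ _ _ (nbhs x) (nbhs (f x)) (nbhs (g x)) _ _ _ f g (cf x) (cg x)).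
Qed.

Lemma continuous_fst X Y : continuous (@fst X Y).
Proof. by move=> z; exact: cvg_fst. Qed.

Lemma continuous_snd X Y : continuous (@snd X Y).
Proof. by move=> z; exact: cvg_snd. Qed.

Lemma continuous_reparam X (a b : R) :
  continuous (fun z : X * R => (z.1, a * z.2 + b)).
Proof.
apply: continuous_mkpair; first exact: continuous_fst.
move=> z; apply: cvgD; last exact: cvg_cst.
by apply: cvgMr; exact: continuous_snd.
Qed.

Lemma closed_cylinder X (a b : R) : closed ([set: X] `*` `[a, b]).
Proof.
have -> : [set: X] `*` `[a, b] = snd @^-1` `[a, b].
  by apply/seteqP; split => [[x t] []|[x t]].
by apply: preimage_closed; [move=> z _; exact: continuous_snd|exact: itv_closed].
Qed.

Lemma homotopic_sym X Y (f g : X -> Y) : homotopic f g -> homotopic g f.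
Proof.
move=> [F [cF F0 F1]].
exists (F \o (fun z => (z.1, -1 * z.2 + 1))); split.
- apply: within_continuous_comp cF; first exact: continuous_reparam.
  move=> [x t] [_] /=; rewrite !in_itv /= => /andP[t0 t1]; split => //.
  by rewrite mulN1r addrC subr_ge0 t1 lerBlDr lerDl.
- by move=> x /=; rewrite mulr0 add0r F1.
- by move=> x /=; rewrite mulr1 addNr F0.
Qed.

Lemma homotopic_trans X Y (f g h : X -> Y) :
  homotopic f g -> homotopic g h -> homotopic f h.
Proof.
move=> [F [cF F0 F1]] [F' [cF' F'0 F'1]].
have h0 : 0 < 2^-1 :> R by rewrite invr_gt0.
pose P := F \o (fun z : X * R => (z.1, 2 * z.2 + 0)).
pose Q := F' \o (fun z : X * R => (z.1, 2 * z.2 + -1)).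
pose K z := if z.2 <= 2^-1 then P z else Q z.
have cP : {within [set: X] `*` `[0, 2^-1], continuous P}.
  apply: within_continuous_comp cF; first exact: continuous_reparam.
  move=> [x t] [_] /=; rewrite !in_itv /= addr0 => /andP[t0 t1]; split => //.
  by rewrite mulr_ge0// mulrC -ler_pdivlMr// div1r.
have cQ : {within [set: X] `*` `[2^-1, 1], continuous Q}.
  apply: within_continuous_comp cF'; first exact: continuous_reparam.
  move=> [x t] [_] /=; rewrite !in_itv /= => /andP[t0 t1]; split => //.
  rewrite subr_ge0 lerBlDr mulrC -ler_pdivrMr// div1r t0 /=.
  by rewrite -[leRHS]mul1r ler_wpM2r.
exists K; split.
- have -> : [set: X] `*` `[0, 1] =
      ([set: X] `*` `[0, 2^-1]) `|` ([set: X] `*` `[2^-1, 1 : R]).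
    apply/seteqP; split => [[x t] [_]|[x t]] /=; rewrite !in_itv /=.
      move=> /andP[t0 t1]; have [th|/ltW th] := leP t 2^-1; [left|right].
        by split => //; rewrite t0.
      by split => //; rewrite th.
    move=> [] [_] /andP[t0 t1]; split => //.
      by rewrite t0 (le_trans t1) // invf_le1 // ler1n.
    by rewrite t1 (le_trans (ltW h0) t0).
  apply: withinU_continuous.
  + exact: closed_cylinder.
  + exact: closed_cylinder.
  + apply: subspace_eq_continuous cP => -[x t] /set_mem [_] /=.
    by rewrite in_itv /= => /andP[_ th]; rewrite /from_subspace /K /= th.
  + apply: subspace_eq_continuous cQ => -[x t] /set_mem [_] /=.
    rewrite in_itv /= => /andP[th _]; rewrite /from_subspace /K /=.
    case: ifPn => // th'; have -> : t = 2^-1 by apply/le_anti; rewrite th th'.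
    by rewrite /P /Q /= addr0 divff // subrr F1 F'0.
- by move=> x; rewrite /K /P /= (ltW h0) mulr0 addr0 F0.
- move=> x; rewrite /K /= leNgt invf_lt1 // ltr1n /= /Q /= mulr1.
  by rewrite -[2]/(1 + 1) addrK F'1.
Qed.

Lemma homotopic_comp X Y Z (f f' : X -> Y) (g g' : Y -> Z) :
  continuous f' -> continuous g ->
  homotopic f f' -> homotopic g g' -> homotopic (g \o f) (g' \o f').
Proof.
move=> cf cg [F [cF F0 F1]] [K [cK K0 K1]].
apply: (@homotopic_trans _ _ _ (g \o f')).
  exists (g \o F); split => [z|x|x] /=; rewrite ?F0 ?F1 //.
  by apply: (@continuous_comp _ _ _ _ g); [exact: cF|exact: cg].
exists (K \o (fun z => (f' z.1, z.2))); split => [|x|x] /=; rewrite ?K0 ?K1 //.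
apply: within_continuous_comp cK; last by move=> [x t] [].
apply: continuous_mkpair; last exact: continuous_snd.
by move=> z; apply: continuous_comp; [exact: continuous_fst|exact: cf].
Qed.

Definition homotopicb X Y : rel (continuousType X Y) :=
  fun f g => `[< homotopic f g >].

Lemma homotopicb_refl X Y : reflexive (@homotopicb X Y).
Proof. by move=> f; apply/asboolP/homotopic_refl/cts_fun. Qed.

Lemma homotopicb_sym X Y : symmetric (@homotopicb X Y).
Proof. by move=> f g; apply/asboolP/asboolP; exact: homotopic_sym. Qed.

Lemma homotopicb_trans X Y : transitive (@homotopicb X Y).
Proof.
by move=> f g h /asboolP gf /asboolP fh; apply/asboolP/(homotopic_trans gf).
Qed.

Canonical homotopicb_equiv X Y :=
  EquivRel (@homotopicb X Y) (@homotopicb_refl X Y) (@homotopicb_sym X Y)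
    (@homotopicb_trans X Y).

Definition hclass X Y := {eq_quot (homotopicb_equiv X Y)}.

Definition hpi X Y (f : continuousType X Y) : hclass X Y :=
  \pi_(hclass X Y) f.

Definition hcomp X Y Z (g : hclass Y Z) (f : hclass X Y) : hclass X Z :=
  hpi (ctscomp (repr g) (repr f)).

Lemma hpiP X Y (f g : continuousType X Y) : hpi f = hpi g <-> homotopic f g.
Proof.
by split=> [/eqmodP/asboolP|fg] //; apply/eqmodP/asboolP.
Qed.

Lemma hpiK X Y (a : hclass X Y) : hpi (repr a) = a.
Proof. exact: reprK. Qed.

Lemma hcompE X Y Z (g : continuousType Y Z) (f : continuousType X Y) :
  hcomp (hpi g) (hpi f) = hpi (ctscomp g f).
Proof.
by apply/hpiP; apply: homotopic_comp; try exact: cts_fun; apply/hpiP/hpiK.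
Qed.

Lemma hcompA X Y Z T (h : hclass Z T) (g : hclass Y Z) (f : hclass X Y) :
  hcomp h (hcomp g f) = hcomp (hcomp h g) f.
Proof. by rewrite -(hpiK h) -(hpiK g) -(hpiK f) !hcompE ctscompA. Qed.

Lemma hcomp1f X Y (f : hclass X Y) : hcomp (hpi (ctsid Y)) f = f.
Proof. by rewrite -(hpiK f) hcompE ctscomp1f. Qed.

Lemma hcompf1 X Y (f : hclass X Y) : hcomp f (hpi (ctsid X)) = f.
Proof. by rewrite -(hpiK f) hcompE ctscompf1. Qed.

Definition HTop : category := Category hcompA hcomp1f hcompf1.

End Homotopy.

Section Retraction.
Context (X : topologicalType) (rb : continuousType X X).

(* rb is viewed as a retraction of X onto range rb, which carries the subspace
   topology. *)
Definition topological_retraction := forall y, range rb y -> rb y = y.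

Definition corestr (x : X) : range rb := exist _ (rb x) (mem_set (imageT rb x)).

Lemma continuous_corestr : continuous corestr.
Proof. by apply: continuous_comp_initial => x; exact: cts_fun. Qed.

HB.instance Definition _ := isContinuous.Build X (range rb) corestr continuous_corestr.

Definition retr : continuousType X (range rb) := corestr.

Definition rincl_fun : range rb -> X := set_val.

Lemma continuous_incl : continuous rincl_fun.
Proof. exact: initial_continuous. Qed.

HB.instance Definition _ := isContinuous.Build (range rb) X rincl_fun continuous_incl.

Definition rincl : continuousType (range rb) X := rincl_fun.

End Retraction.

Section Height.
Context (X : topologicalType).

Definition minimal_open (x : X) : set X :=
  \bigcap_(U in [set U | open U /\ U x]) U.

Definition top_le (x y : X) := minimal_open x `<=` minimal_open y.

Definition top_chain (c : {fset X}) :=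
  {in c &, forall x y, top_le x y \/ top_le y x}.

(* height = (maximal cardinality of a chain) - 1 *)
Definition has_height (h : nat) :=
  (exists2 c, top_chain c & #|` c| = h.+1) /\
  (forall c, top_chain c -> (#|` c| <= h.+1)%N).

End Height.

(* Main.v *)
From Pilot Require Import Defs.
From mathcomp Require Import all_boot all_order all_algebra all_fingroup finmap.
From mathcomp Require Import all_classical all_reals all_analysis.
From HB Require Import structures.
Import Pilot.Defs.

(** Finite T0 spaces are finite posets, and on a finite poset without beat points
a map homotopic to the identity is the identity ([rigid_homotopy]). For such
spaces the self-homotopy equivalences are the automorphisms, so it suffices to find height-1 posets without beat points
realizing [r] in Top; the homotopical half then follows from
[aut_iso_haut].

The posets. To recognize left translations of a group [K] by incidences alone,
fix an injective rank on [K]. Let [A_s] be the set of elements of rank at most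
that of [s], take two copies of [K] as minimal points, and for every [y] and
[s] a maximal point (a test) above [y] in the first copy and above the
translate [y A_s] in the second; there is also one test above [y] alone, which
corresponds to the empty segment. The segments [A_s] form a chain in which
consecutive members differ by one element, and a permutation of a well-ordered
set preserving all initial segments is the identity; hence a bijection that
preserves incidence, each of the two copies and the set of tests is left
translation by one element of [K] ([segment_rigid]).

The space [X] carries this configuration for [H] and for [G]; in addition the
point [r g] of the first copy of [H] lies below the tests attached to [g].
Four more points hold everything together: [nadir] below all maximal points,
[apex] above all minimal points, and [flag] below only [apex] and [flagtop],
where [flagtop] is above [nadir], [flag] and both second copies. An automorphism
fixes these four, preserves the two second copies together, and separates
[G] from [H] because the set of maximal points above [g] in the first copy of
[G] is strictly contained in the corresponding set of [r g], whereas for points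
in the first copy of [H] that set is contained in no other such set
([inc_aut_coordinates]). By [segment_rigid] it
translates the [G] part by some [g] and the [H] part by some [h], and the
links give [h = r g]. So [Aut X = G]. The same argument with nothing over [H]
shows that the subspace [Z] of the points of [X] without those over [G] has
[Aut Z = H].

The retraction of [X] onto [Z] sends the two copies of [G] to [nadir] and
[flag], and the tests of [G] to [apex]. It is order preserving because
[nadir] and [apex] are comparable with everything on the other level, and
[flag] is below [flagtop] as the second copy of [G] is. As [g]
acts on [Z] as [r g], restriction to [Z] is [r]. *)

Set Implicit Arguments.
Unset Strict Implicit.
Unset Printing Implicit Defensive.

Import Order.TTheory GRing.Theory Num.Theory.
Import numFieldTopology.Exports numFieldNormedType.Exports.

Local Open Scope classical_set_scope.

(** * Realizations from isomorphisms onto automorphism groups *)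

Section RealizationFromActions.
Local Open Scope cat_scope.

Definition aut_iso (C : category) (X : C) (G : groupType)
    (a : G -> aut X) :=
  bijective a /\ {morph a : x y / (x * y)%g}.

(** The automorphisms of [Y] that correspond to restrictions are [b (r g)], so the
natural map is [r] read through the isomorphisms [a] and [b]. *)
Lemma realizes_of_actions (C : category) (X Y : C) (rb : hom X Y)
    (ib : hom Y X) (G H : groupType) (r : G -> H) (a : G -> aut X)
    (b : H -> aut Y) :
  rb \c ib = idm Y -> aut_iso a -> aut_iso b ->
  (forall g, autm (a g) \c ib = ib \c autm (b (r g))) ->
  realizes rb ib r.
Proof.
move=> rbib [[phi aK phiK] aM] [[psi bK psiK] bM] ab; split=> //.
  by move=> f; exists (b (r (phi f))); rewrite -ab phiK.
exists (fun f => b (r (phi f))); split=> [f|].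
  by rewrite -compmA -{2}(phiK f) ab compmA rbib comp1m.
pose phiM := isMultiplicative.Build _ _ phi (can2_gmulfM (f :=
  HB.pack_for {multiplicative G -> aut X} a (isMultiplicative.Build _ _ a aM)) aK phiK).
pose psiM := isMultiplicative.Build _ _ psi (can2_gmulfM (f :=
  HB.pack_for {multiplicative H -> aut Y} b (isMultiplicative.Build _ _ b bM)) bK psiK).
exists (HB.pack_for {multiplicative aut X -> G} phi phiM).
exists (HB.pack_for {multiplicative aut Y -> H} psi psiM).
by split=> [||f /=]; [exists a|exists b|rewrite bK].
Qed.

(** Conjugation along an isomorphism [Y ~ Z] allows the automorphisms of a
convenient model [Z] of the retract to be used in place of those of [Y]. *)
Section Conjugation.
Context (C : category) (Y Z : C) (u : hom Y Z) (v : hom Z Y).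
Hypotheses (uv : u \c v = idm Z) (vu : v \c u = idm Y).

Lemma conj_compE (f g : hom Z Z) :
  ((v \c f) \c u) \c ((v \c g) \c u) = (v \c (f \c g)) \c u.
Proof. by rewrite !compmA -(compmA _ u) uv compm1. Qed.

Lemma conj_idE (f : hom Z Z) : f = idm Z -> (v \c f) \c u = idm Y.
Proof. by move=> ->; rewrite compm1. Qed.

Definition conj_aut (f : aut Z) : aut Y :=
  Aut (etrans (conj_compE (autm_inv f) (autm f)) (conj_idE (autmK f)))
      (etrans (conj_compE (autm f) (autm_inv f)) (conj_idE (autmVK f))).

End Conjugation.

Lemma aut_iso_conj (C : category) (Y Z : C) (u : hom Y Z) (v : hom Z Y)
    (uv : u \c v = idm Z) (vu : v \c u = idm Y) (H : groupType)
    (b : H -> aut Z) :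
  aut_iso b -> aut_iso (fun h => conj_aut uv vu (b h)).
Proof.
move=> [[b' bK b'K] bM]; split; last first.
  by move=> g h; apply: autm_inj; rewrite /= bM /= conj_compE.
exists (fun f => b' (conj_aut vu uv f)) => [h|f].
  rewrite -[RHS]bK; congr b'; apply: autm_inj => /=.
  by rewrite !compmA uv comp1m -compmA uv compm1.
apply: autm_inj; rewrite /= b'K /=.
by rewrite !compmA vu comp1m -compmA vu compm1.
Qed.

(** The retract [Y] of [X] may be replaced by any isomorphic object [Z] on which
[H] acts compatibly with [j : Z -> X]. *)
Lemma realizes_iso (C : category) (X Y Z : C) (rb : hom X Y) (ib : hom Y X)
    (j : hom Z X) (u : hom Y Z) (v : hom Z Y) (G H : groupType) (r : G -> H)
    (a : G -> aut X) (b : H -> aut Z) :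
  rb \c ib = idm Y -> u \c v = idm Z -> v \c u = idm Y -> ib \c v = j ->
  aut_iso a -> aut_iso b ->
  (forall g, autm (a g) \c j = j \c autm (b (r g))) ->
  realizes rb ib r.
Proof.
move=> rbib uv vu ibv aR bR ab.
apply: (realizes_of_actions rbib aR (aut_iso_conj uv vu bR)) => g /=.
by rewrite !compmA ibv -ab -ibv -!compmA vu compm1.
Qed.

End RealizationFromActions.

(** * Automorphisms in the homotopy category *)

Section HomotopyRigid.
Context (R : realType).

Definition hrepr (X Y : topologicalType) (f : hclass R X Y) : continuousType X Y :=
  generic_quotient.repr f.

Definition homotopy_rigid (X : topologicalType) :=
  forall f : continuousType X X, homotopic R f idfun -> f = ctsid X.

Lemma hpi_compE (X : topologicalType) (f g : continuousType X X) :
  ctscomp f g = ctsid X -> hcomp (hpi R f) (hpi R g) = hpi R (ctsid X).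
Proof. by move=> fg; rewrite hcompE fg. Qed.

Definition haut (X : Top) (f : aut X) : @aut (HTop R) X :=
  @Aut (HTop R) X _ _ (hpi_compE (autmK f)) (hpi_compE (autmVK f)).

(** On a homotopy rigid space, representatives of inverse homotopy classes are
inverse to each other on the nose, and homotopic automorphisms [f], [g] are equal
because [g^-1 f] is homotopic to the identity. *)
Lemma aut_iso_haut (X : Top) (G : groupType) (a : G -> aut X) :
  homotopy_rigid X -> aut_iso a -> aut_iso (fun g => haut (a g)).
Proof.
move=> rigX [[a' aK a'K] aM]; split; last first.
  by move=> g h; apply: autm_inj; rewrite /= aM hcompE.
have hcompK (p q : hclass R X X) : hcomp p q = hpi R (ctsid X) ->
    ctscomp (hrepr p) (hrepr q) = ctsid X.
  by move=> /hpiP /rigX.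
pose unh (f : @aut (HTop R) X) : aut X := @Aut Top X (hrepr (autm f))
  (hrepr (autm_inv f)) (hcompK _ _ (autmK f)) (hcompK _ _ (autmVK f)).
have unhK f : haut (unh f) = f by apply: autm_inj; rewrite /= hpiK.
have hautI : injective (@haut X).
  move=> f g fg.
  have /hpiP : hpi R (ctscomp (autm_inv g) (autm f)) = hpi R (ctsid X).
    have fgE : hpi R (autm f : continuousType X X) = hpi R (autm g : continuousType X X).
      exact: (congr1 (@autm _ _) fg).
    by rewrite -hcompE fgE; exact: hpi_compE (autmK g).
  move=> /rigX gf; apply: autm_inj.
  have gf' : (autm_inv g \c autm f)%cat = idm X by exact: gf.
  by rewrite -[LHS]comp1m -(autmVK g) -compmA gf' compm1.
exists (fun f => a' (unh f)) => [g|f]; last by rewrite a'K unhK.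
by rewrite -[RHS]aK; congr a'; apply: hautI; rewrite unhK.
Qed.

End HomotopyRigid.

(** * Alexandrov topologies *)

Definition alexandrov (T : Type) (le : T -> T -> Prop) : Type := T.

Section Alexandrov.
Context (T : Type) (le : T -> T -> Prop).
Local Notation X := (alexandrov le).

HB.instance Definition _ := gen_eqMixin X.
HB.instance Definition _ := gen_choiceMixin X.

Definition down_closed (U : set X) := forall x y, le x y -> U y -> U x.

Fact down_closedT : down_closed setT. Proof. by []. Qed.

Fact down_closedI : setI_closed down_closed.
Proof. by move=> U V dU dV x y xy [Uy Vy]; split; [apply: dU Uy|apply: dV Vy]. Qed.

Fact down_closed_bigU (I : Type) (U : I -> set X) :
  (forall i, down_closed (U i)) -> down_closed (\bigcup_i U i).
Proof. by move=> dU x y xy [i _ Uy]; exists i => //; apply: dU Uy. Qed.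

HB.instance Definition _ :=
  isOpenTopological.Build X down_closedT down_closedI down_closed_bigU.

Lemma alexandrov_openE (U : set X) : open U = down_closed U.
Proof. by []. Qed.

Definition preorder := (forall x, le x x) /\ (forall x y z, le x y -> le y z -> le x z).

Hypothesis pre : preorder.

Lemma alexandrov_openD (y : X) : open [set x : X | le x y].
Proof. by rewrite alexandrov_openE => x z xz; exact: pre.2. Qed.

Lemma nbhs_alexandrov (x : X) (U : set X) :
  nbhs x U <-> [set z : X | le z x] `<=` U.
Proof.
split=> [|DU].
  by rewrite nbhsE => -[V [oV Vx] VU] z zx; apply/VU/(oV _ x).
rewrite nbhsE; exists [set z : X | le z x] => //.
by split; [exact: alexandrov_openD|exact: pre.1].
Qed.

Lemma minimal_openE (x : X) : minimal_open x = [set z : X | le z x].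
Proof.
apply/seteqP; split=> [z|z zx U [oU Ux]]; last exact: oU Ux.
by apply; split; [exact: alexandrov_openD|exact: pre.1].
Qed.

Lemma top_leE (x y : X) : top_le x y <-> le x y.
Proof.
rewrite /top_le !minimal_openE; split=> [|xy z zx]; first by apply; exact: pre.1.
exact: pre.2 xy.
Qed.

Lemma alexandrov_kolmogorov : (forall x y, le x y -> le y x -> x = y) ->
  kolmogorov_space X.
Proof.
move=> anti x y xy.
have [lxy|nxy] := pselect (le x y).
  exists [set z : X | le z x]; left; split; apply/mem_set.
    by apply/nbhs_alexandrov.
  by move=> /= lyx; move/eqP: xy; apply; exact: anti.
exists [set z : X | le z y]; right; split; apply/mem_set => //.
by apply/nbhs_alexandrov.
Qed.

Lemma alexandrov_connected (a b : X) : le a b ->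
  (forall x, le a x \/ le x b) -> connected [set: X].
Proof.
move=> ab abx B [x Bx] [C oC BC] [D cD BD].
rewrite setTI in BC; rewrite setTI in BD; subst C.
have uB u v : le u v -> B u -> B v.
  move=> uv; rewrite BD => Du; apply: contrapT => nDv.
  have /closed_openC : closed D by [].
  by move=> /(_ u v uv nDv) /(_ Du).
have Ba : B a.
  by have [ax|xb] := abx x; [exact: oC ax Bx|exact: oC ab (uB _ _ xb Bx)].
apply/seteqP; split=> // y _.
have [ay|yb] := abx y; first exact: uB ay Ba.
exact: oC yb (uB _ _ ab Ba).
Qed.

End Alexandrov.

Lemma alexandrov_continuous (T T' : Type) (le : T -> T -> Prop)
    (le' : T' -> T' -> Prop) (f : alexandrov le -> alexandrov le') :
  (forall x y, le x y -> le' (f x) (f y)) -> continuous f.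
Proof.
move=> fle; apply/continuousP => U; rewrite !alexandrov_openE => dU x y xy.
exact/dU/fle.
Qed.

Lemma continuous_alexandrov (T T' : Type) (le : T -> T -> Prop)
    (le' : T' -> T' -> Prop) (f : alexandrov le -> alexandrov le') :
  preorder le' -> continuous f -> forall x y, le x y -> le' (f x) (f y).
Proof.
move=> pre /continuousP fc x y xy.
have := fc _ (@alexandrov_openD _ _ pre (f y)); rewrite alexandrov_openE => dU.
by apply: (dU _ _ xy); exact: pre.1.
Qed.

(** For finite posets this says that there is no beat point: the identity is
comparable with no other monotone map. *)
Definition monotone_rigid (T : Type) (le : T -> T -> Prop) :=
  forall f : T -> T, (forall x y, le x y -> le (f x) (f y)) ->
  (forall x, le (f x) x) \/ (forall x, le x (f x)) -> forall x, f x = x.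

(** * Homotopies of finite spaces *)

Lemma locally_constant_itv (R : realType) (P : R -> Prop) :
  (forall t, (`[0%R, 1%R] : set R) t -> \forall s \near t, (`[0%R, 1%R] : set R) s -> (P s <-> P t)) ->
  P 0%R -> P 1%R.
Proof.
move=> locP P0; set I : set R := `[0%R, 1%R] in locP *.
have I1 : I 1%R by rewrite /I /= in_itv /= ler01 lexx.
suff [] : (I `&` P) 1%R by [].
have IP (Q : set R) : (forall t, I t -> Q t -> \forall s \near t, I s -> Q s) ->
    I `&` Q = I `&` (~` I `|` Q)°.
  move=> locQ; apply/seteqP; split=> t [It Qt]; split=> //.
    by apply: filterS (locQ t It Qt) => s /= IQ; have [/IQ|] := pselect (I s); [right|left].
  by have /= [] := interior_subset Qt.
suff -> : I `&` P = I by [].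
apply: segment_connected.
- by exists 0%R; split=> //; rewrite /I /= in_itv /= ler01 lexx.
- exists (~` I `|` P)°; first exact: open_interior.
  by apply: IP => t It Pt; apply: filterS (locP t It) => s /[apply] -[_]; apply.
- exists (~` (~` I `|` ~` P)°); first by rewrite closedC; exact: open_interior.
  have /seteqP[IP1 IP2] : I `&` ~` P = I `&` (~` I `|` ~` P)°.
    apply: IP => t It nPt.
    by apply: filterS (locP t It) => s /[apply] -[PsPt _] /PsPt.
  apply/seteqP; split=> t [It Pt]; split=> //.
    by move=> nPt; have [] := IP2 t (conj It nPt).
  by apply: contrapT => nPt; apply: Pt; have [] := IP1 t (conj It nPt).
Qed.

Section HomotopyOfFiniteSpaces.
Context (R : realType) (T : Type) (le : T -> T -> Prop).
Local Notation X := (alexandrov le).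
Hypotheses (pre : preorder le) (finX : finite_set [set: X]).

(** Values can only decrease near a given time [t], since the points below
[F (x, t)] form a neighbourhood of it; finiteness of the space gives one
neighbourhood of [t] for all points. At [s = t] this says that each stage of the
homotopy is monotone. *)
Lemma homotopy_near (F : X * R -> X) :
  {within [set: X] `*` (`[0%R, 1%R] : set R), continuous F} ->
  forall t, (`[0%R, 1%R] : set R) t -> \forall s \near t, (`[0%R, 1%R] : set R) s ->
    forall x y, le y x -> le (F (y, s)) (F (x, t)).
Proof.
move=> /subspace_continuousP cF t It.
have near1 (x : X) : \forall s \near t, (`[0%R, 1%R] : set R) s ->
    forall y, le y x -> le (F (y, s)) (F (x, t)).
  have Dx : nbhs (F (x, t)) [set z : X | le z (F (x, t))].
    exact/(nbhs_alexandrov pre).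
  have [[U V] /= [/(nbhs_alexandrov pre) xU Vt] UV] := cF (x, t) (conj I It) _ Dx.
  apply: filterS Vt => s Vs Is y yx; apply: (UV (y, s)) => //=.
  by split=> //=; exact: xU.
have /finite_fsetP [A AE] := finX.
have := @filter_bigI _ X A (fun x s => (`[0%R, 1%R] : set R) s ->
    forall y, le y x -> le (F (y, s)) (F (x, t))) (nbhs t) (nbhs_filter t) (fun x _ => near1 x).
apply: (@filterS _ (nbhs t)) => s As Is x y yx; apply: (As x) => //=.
by have : [set: X] x by []; rewrite AE.
Qed.

(** The set of times at which the homotopy is the identity is open and closed.
Near a time [t] all stages are below the one at [t]. If that one is the
identity, the nearby stages are monotone maps below the identity; if a nearby
stage is the identity, the stage at [t] is a monotone map above the identity. In
both cases rigidity makes the map the identity. *)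
Lemma rigid_homotopy (f : X -> X) : monotone_rigid le ->
  homotopic R f idfun -> f = id.
Proof.
move=> rig /homotopic_sym [F [cF F0 F1]].
suff : forall x, F (x, 1%R) = x.
  by move=> F1'; apply/funext => x; rewrite -F1 F1'.
have homF t : (`[0%R, 1%R] : set R) t -> forall x y, le x y -> le (F (x, t)) (F (y, t)).
  by move=> It x y; exact: (nbhs_singleton (homotopy_near cF It)).
apply: (@locally_constant_itv _ (fun t => forall x, F (x, t) = x)) => //.
move=> t It; apply: filterS (homotopy_near cF It) => s + Is => /(_ Is) Fst.
split=> FE.
  apply: rig; first exact: homF.
  by right=> x; rewrite -{1}(FE x); apply: Fst; exact: pre.1.
apply: rig; first exact: homF.
by left=> x; rewrite -{2}(FE x); apply: Fst; exact: pre.1.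
Qed.

End HomotopyOfFiniteSpaces.

(** * Recognizing left translations by initial segments *)

Local Open Scope group_scope.

Section Segments.
Context (K : groupType) (rk : K -> nat).
Hypothesis rkI : injective rk.

(** Membership of [x] in the left translate by [y] of the initial segment that
ends at [s]; [None] stands for the empty segment. *)
Definition segment (y : K) (s : option K) (x : K) : Prop :=
  if s is Some t then (rk (y^-1 * x) <= rk t)%N else False.

Lemma segmentM k y s x : segment (k * y) s (k * x) <-> segment y s x.
Proof. by case: s => //= s; rewrite invgM -mulgA mulKg. Qed.

Lemma segment_mul y t s : segment y (Some s) (y * t) <-> (rk t <= rk s)%N.
Proof. by rewrite /= mulKg. Qed.

(** A strictly increasing self-map of a well-ordered set never decreases an
element: at a least counterexample [t], its image [p t] would be a smaller one. *)
Lemma rank_increasing (p : K -> K) :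
  (forall s t, (rk s < rk t)%N -> (rk (p s) < rk (p t))%N) ->
  forall t, (rk t <= rk (p t))%N.
Proof.
move=> pmono t; have [n] := ubnP (rk t); elim: n t => // n IH t tn.
rewrite leqNgt; apply/negP => pt.
by have := IH _ (leq_trans pt tn); rewrite leqNgt pmono.
Qed.

(** For fixed [y], the map sending [t] to [(phi y)^-1 * chi (y * t)] permutes [K] and maps
initial segments to initial segments, so it and its inverse are strictly
increasing and it is the identity. Hence [chi (y * t) = phi y * t] for all [y] and
[t], and setting [y = 1] and [t = 1] identifies both maps with the translation by
[phi 1]. *)
Lemma segment_rigid (phi chi chi' : K -> K) (sigma : K -> option K -> option K) :
  cancel chi' chi -> cancel chi chi' ->
  (forall y s x, segment (phi y) (sigma y s) (chi x) <-> segment y s x) ->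
  exists k, [/\ forall x, phi x = k * x, forall x, chi x = k * x &
                forall y s, sigma y s = s].
Proof.
move=> chi'K chiK segE.
have sigmaS y s : exists t, sigma y (Some s) = Some t.
  case E: (sigma y (Some s)) => [t|]; first by exists t.
  by have := (segE y (Some s) (y * s)).2; rewrite E; case; apply/segment_mul.
have sigmaN y : sigma y None = None.
  case E: (sigma y None) => [t|//].
  have [] := (segE y None (chi' (phi y * t))).1.
  by rewrite E chi'K; apply/segment_mul.
have chiM y t : chi (y * t) = phi y * t.
  pose p u := (phi y)^-1 * chi (y * u).
  pose p' u := y^-1 * chi' (phi y * u).
  have pK : cancel p p' by move=> u; rewrite /p' /p mulVKg chiK mulKg.
  have p'K : cancel p' p by move=> u; rewrite /p' /p mulVKg chi'K mulKg.
  have pE s : exists u, forall v, (rk (p v) <= rk u)%N = (rk v <= rk s)%N.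
    have [u su] := sigmaS y s; exists u => v.
    apply/idP/idP => [pvu|vs].
      by apply/(segment_mul y)/segE; rewrite su.
    by have /segE := (segment_mul y v s).2 vs; rewrite su.
  have pmono s u : (rk s < rk u)%N -> (rk (p s) < rk (p u))%N.
    move=> su; have [v vE] := pE s.
    by apply: (@leq_ltn_trans (rk v)); [rewrite vE|rewrite ltnNge vE -ltnNge].
  have p'mono s u : (rk s < rk u)%N -> (rk (p' s) < rk (p' u))%N.
    move=> su; rewrite ltnNge leq_eqVlt; apply/negP => /orP[/eqP/rkI|/pmono].
      by move=> /(can_inj p'K) us; move: su; rewrite us ltnn.
    by rewrite !p'K => /(ltn_trans su); rewrite ltnn.
  (* [p] and its inverse both increase ranks weakly, so [p] preserves them. *)
  suff pt : p t = t by rewrite -{2}pt /p mulVKg.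
  apply/rkI/eqP; rewrite eqn_leq (rank_increasing pmono) andbT.
  by rewrite -{2}(pK t) (rank_increasing p'mono).
have chiE x : chi x = phi 1 * x by rewrite -chiM mul1g.
have phiE x : phi x = phi 1 * x.
  by rewrite -chiE -[LHS]mulg1 -chiM mulg1.
exists (phi 1); split=> // y [s|//]; have [u su] := sigmaS y s.
have usE v : (rk v <= rk u)%N = (rk v <= rk s)%N.
  apply/idP/idP => [vu|/(segment_mul y)/segE]; last by rewrite su chiM => /segment_mul.
  by apply/(segment_mul y)/segE; rewrite su chiM; apply/segment_mul.
rewrite su; congr Some; apply/rkI/eqP.
by rewrite eqn_leq -usE leqnn usE leqnn.
Qed.

End Segments.

(** * The incidence poset *)

(** The minimal points are on the first line and the maximal ones on the second.
Those indexed by [V] lie over [H] through a map [q : V -> H] below; they are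
the part of the space that the retraction collapses. *)
Inductive point (H V : Type) :=
  | nadir | flag | baseH of H | copyH of H | baseV of V | copyV of V
  | apex | flagtop | testH of H & option H | testV of V & option V.

Arguments nadir {H V}.
Arguments flag {H V}.
Arguments apex {H V}.
Arguments flagtop {H V}.
Arguments baseH {H V}.
Arguments copyH {H V}.
Arguments baseV {H V}.
Arguments copyV {H V}.
Arguments testH {H V}.
Arguments testV {H V}.

Section Incidence.
Context (H V : Type) (sgH : H -> option H -> H -> Prop) (q : V -> H)
  (sgV : V -> option V -> V -> Prop).
Local Notation point := (point H V).

Definition inc (x y : point) : Prop :=
  match x, y with
  | nadir, (apex | flagtop | testH _ _ | testV _ _) => True
  | (flag | baseH _ | copyH _ | baseV _ | copyV _), apex => True
  | (flag | copyH _ | copyV _), flagtop => True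
  | baseH h, testH h' _ => h = h'
  | copyH x, testH y s => sgH y s x
  | baseV v, testV v' _ => v = v'
  | copyV x, testV y s => sgV y s x
  | baseH h, testV v _ => h = q v
  | _, _ => False
  end.

Definition le (x y : point) := x = y \/ inc x y.

Lemma inc_trans x y z : inc x y -> inc y z -> False.
Proof. by case: x => [||x|x|x|x|||x s|x s]; case: y; case: z. Qed.

Lemma le_preorder : preorder le.
Proof.
split=> [x|x y z]; first by left.
move=> [->|xy] [<-|yz]; [by left|by right|by right|].
by have := inc_trans xy yz.
Qed.

Lemma le_anti x y : le x y -> le y x -> x = y.
Proof. by move=> [//|xy] [//|yx]; have := inc_trans xy yx. Qed.

Lemma inc_apex x y : inc x y -> inc x apex.
Proof. by case: x; case: y. Qed.

Lemma inc_nadir x y : inc x y -> inc nadir y.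
Proof. by case: x; case: y. Qed.


(** * Automorphisms of the incidence poset *)

Definition inc_aut (f f' : point -> point) :=
  [/\ cancel f f', cancel f' f & forall x y, inc (f x) (f y) <-> inc x y].

Lemma inc_aut_sym f f' : inc_aut f f' -> inc_aut f' f.
Proof. by move=> [fK f'K fE]; split=> // x y; rewrite -fE !f'K. Qed.

Lemma le_inc_aut f f' : cancel f f' -> cancel f' f ->
  (forall x y, le x y -> le (f x) (f y)) ->
  (forall x y, le x y -> le (f' x) (f' y)) -> inc_aut f f'.
Proof.
move=> fK f'K fle f'le; split=> // x y.
have inc_neq z : ~ inc z z by move=> zz; have := inc_trans zz zz.
split=> [fxy|xy].
  have := f'le (f x) (f y) (or_intror fxy).
  by rewrite !fK => -[xy|//]; move: fxy; rewrite xy => /inc_neq.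
have [/(can_inj fK) xE|//] := fle x y (or_intror xy).
by move: xy; rewrite xE => /inc_neq.
Qed.

(** The empty segment has no member, and each point of a second copy belongs to
some segment. The latter gives it a test besides [flagtop]; the former, applied
to the tests of the empty segments, is what singles out [nadir]. *)
Hypothesis sgHN : forall y x, ~ sgH y None x.
Hypothesis sgHI : forall x, exists s, sgH x (Some s) x.
Hypothesis sgVI : forall x, exists s, sgV x (Some s) x.

(** Every maximal point has two points below it and every minimal point has two
above it. A monotone map below the identity fixes the minimal points; if it
moved a maximal point [x], its value there would have to equal every minimal
point below [x]. The other case is dual. *)
Lemma monotone_rigid_le : monotone_rigid le.
Proof.
move=> f fle [down|up] x.
  have fbot b : inc b apex -> f b = b.
    by have [//|fbb bA] := down b; have := inc_trans fbb bA.
  have [//|fxx] := down x.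
  have fxE b : inc b x -> f x = b.
    move=> bx; have bA := inc_apex bx.
    have := fle b x (or_intror bx); rewrite (fbot _ bA) => -[//|bfx].
    by have := inc_trans bfx fxx.
  have two b c : inc b x -> inc c x -> b <> c -> f x = x.
    by move=> /fxE <- /fxE <-.
  have nx := inc_nadir fxx.
  case: x fxx nx {fxE} two => [||h|h|v|v|||h s|v s] //= _ _ two.
  - exact: (two nadir flag).
  - exact: (two nadir flag).
  - exact: (two nadir (baseH h)).
  - exact: (two nadir (baseV v)).
have ftop t : inc nadir t -> f t = t.
  by have [//|tft nt] := up t; have := inc_trans nt tft.
have [//|xfx] := up x.
have fxE t : inc x t -> f x = t.
  move=> xt; have nt := inc_nadir xt.
  have := fle x t (or_intror xt); rewrite (ftop _ nt) => -[//|fxt].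
  by have := inc_trans xfx fxt.
have two b c : inc x b -> inc x c -> b <> c -> f x = x.
  by move=> /fxE <- /fxE <-.
have nx := inc_apex xfx.
case: x xfx nx {fxE} two => [||h|h|v|v|||h s|v s] //= _ _ two.
- exact: (two apex flagtop).
- exact: (two apex flagtop).
- exact: (two apex (testH h None)).
- exact: (two apex flagtop).
- exact: (two apex (testV v None)).
- exact: (two apex flagtop).
Qed.

Section Rigidity.
Context (h1 : H).

(** Only [apex] is above all minimal points, since [flagtop] is not above
[baseH h1] and the tests are not above [flag]. *)
Lemma inc_aut_apex f f' : inc_aut f f' -> f apex = apex.
Proof.
move=> [fK f'K fE].
have fA b : inc b apex -> inc b (f apex).
  move=> bA; rewrite -(f'K b) fE; apply: (@inc_apex _ (f' apex)).
  by rewrite -fE !f'K.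
case: (f apex) (fA nadir I) (fA flag I) (fA (baseH h1) I) => //.
Qed.

(** Only [nadir] is below all maximal points: [flagtop] excludes the first copies,
and the test of the empty segment at [h1] excludes the other candidates. *)
Lemma inc_aut_nadir f f' : inc_aut f f' -> f nadir = nadir.
Proof.
move=> [fK f'K fE].
have fA b : inc nadir b -> inc (f nadir) b.
  move=> bA; rewrite -(f'K b) fE; apply: (@inc_nadir (f' nadir)).
  by rewrite -fE !f'K.
case: (f nadir) (fA flagtop I) (fA (testH h1 None) I) => // x _.
by move=> /sgHN.
Qed.

(** Only [flag] has just one point besides [apex] above it; every other minimal
point has two. *)
Lemma inc_aut_flag f f' : inc_aut f f' -> f flag = flag /\ f flagtop = flagtop.
Proof.
move=> fA; have fapex := inc_aut_apex fA; have fnadir := inc_aut_nadir fA.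
case: fA => fK f'K fE.
have fI := can_inj fK.
have onlyC t : inc (f flag) t -> t = apex \/ t = f flagtop.
  rewrite -{1}(f'K t) fE => ft.
  have [e|e] : apex = f' t \/ flagtop = f' t by case: (f' t) ft => // _; [left|right].
    by left; rewrite -(f'K t) -e.
  by right; rewrite e f'K.
have two t u : inc (f flag) t -> inc (f flag) u -> t <> apex -> u <> apex -> t = u.
  by move=> /onlyC[->|->] // /onlyC[->|->].
have fflag : f flag = flag.
  have : f flag <> nadir by rewrite -fnadir => /fI.
  have : inc (f flag) apex by rewrite -fapex fE.
  case E: (f flag) two => [||h|h|v|v|||h s|v s] //= two _ _.
  - by have := two (testH h None) (testH h (Some h)) erefl erefl; case=> //.
  - have [s hs] := sgHI h.
    by have := two flagtop (testH h (Some s)) I hs; case=> //.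
  - by have := two (testV v None) (testV v (Some v)) erefl erefl; case=> //.
  - have [s hs] := sgVI v.
    by have := two flagtop (testV v (Some s)) I hs; case=> //.
split=> //.
have : f flagtop <> apex by rewrite -fapex => /fI.
have : inc flag (f flagtop) by rewrite -fflag fE.
by case: (f flagtop).
Qed.

(** These are the points of the first copies. *)
Definition based (x : point) := inc x apex /\ ~ inc x flagtop.

Lemma inc_aut_based f f' x : inc_aut f f' -> based x -> based (f x).
Proof.
move=> fA [xA xF]; split.
  by rewrite -(inc_aut_apex fA); case: fA => _ _ ->.
by rewrite -(inc_aut_flag fA).2; case: fA => _ _ ->.
Qed.

(** The points above [baseV v] are also above [baseH (q v)]. If [f] moved [baseV v]
to some [baseH h], then its test of the empty segment would be above
[f (baseH (q v))] as well, which forces that point to be [baseH h] too and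
contradicts injectivity. *)
Lemma inc_aut_baseV f f' v : inc_aut f f' -> exists v', f (baseV v) = baseV v'.
Proof.
move=> fA.
have [vA vF] : based (f (baseV v)) by apply: (inc_aut_based fA); split.
have [wA wF] : based (f (baseH (q v))) by apply: (inc_aut_based fA); split.
case: (fA) => fK f'K fE.
have vw t : inc (f (baseV v)) t -> inc (f (baseH (q v))) t.
  by rewrite -(f'K t) !fE; case: (f' t) => // u s /= <-.
case E: (f (baseV v)) vA vF => [||h|h|u|u|||h s|u s] //= _ _; last by exists u.
have := vw (testH h None); rewrite E => /(_ erefl).
case E': (f (baseH (q v))) wA wF => [||k|k|u|u|||k s|u s] //= _ wF.
  by move=> hk; have := can_inj fK (etrans E (esym (etrans E' (congr1 baseH hk)))).
Qed.

Lemma inc_aut_baseH f f' h : inc_aut f f' -> exists h', f (baseH h) = baseH h'.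
Proof.
move=> fA; have [hA hF] : based (f (baseH h)) by apply: (inc_aut_based fA); split.
case E: (f (baseH h)) hA hF => [||k|k|v|v|||k s|v s] //= _ hF; first by exists k.
have [v' f'v] := inc_aut_baseV v (inc_aut_sym fA).
by case: fA => fK _ _; move: f'v; rewrite -E fK.
Qed.

Lemma inc_aut_baseV_fiber f f' v v' h' : inc_aut f f' ->
  f (baseV v) = baseV v' -> f (baseH (q v)) = baseH h' -> h' = q v'.
Proof.
move=> [fK f'K fE] vE hE.
have : inc (f (baseV v)) (testV v' None) by rewrite vE.
rewrite -{1}(f'K (testV v' None)) fE => vt.
have : inc (baseH (q v)) (f' (testV v' None)).
  by case: (f' _) vt => //= u s ->.
by rewrite -fE f'K hE.
Qed.

Lemma inc_aut_testV f f' v s : inc_aut f f' ->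
  exists s', f (testV v s) = testV (if f (baseV v) is baseV w then w else v) s'.
Proof.
move=> fA; have [w vw] := inc_aut_baseV v fA; rewrite vw.
case: (fA) => fK f'K fE.
have := (fE (baseV v) (testV v s)).2 erefl; rewrite vw.
case E: (f (testV v s)) => [||||||||h t|u t] //=; last by move=> ->; exists t.
by have := can_inj fK (etrans (inc_aut_apex fA) (esym E)).
Qed.

Lemma inc_aut_testH f f' h s : inc_aut f f' ->
  exists s', f (testH h s) = testH (if f (baseH h) is baseH w then w else h) s'.
Proof.
move=> fA; have [w hw] := inc_aut_baseH h fA; rewrite hw.
case: (fA) => fK f'K fE.
have := (fE (baseH h) (testH h s)).2 erefl; rewrite hw.
case E: (f (testH h s)) => [||||||||k t|u t] //=.
- by have := can_inj fK (etrans (inc_aut_apex fA) (esym E)).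
- by move=> ->; exists t.
have [t' ] := inc_aut_testV u t (inc_aut_sym fA).
by rewrite -E fK.
Qed.

Lemma inc_aut_copyH f f' x : inc_aut f f' -> exists x', f (copyH x) = copyH x'.
Proof.
move=> fA; case: (fA) => fK f'K fE.
have xA : inc (f (copyH x)) apex by rewrite -(inc_aut_apex fA) fE.
have xF : inc (f (copyH x)) flagtop by rewrite -(inc_aut_flag fA).2 fE.
have [s xs] := sgHI x.
have [t xt] := inc_aut_testH x (Some s) fA.
have := (fE (copyH x) (testH x (Some s))).2 xs; rewrite xt.
case E: (f (copyH x)) xA xF => [||h|h|u|u|||h r|u r] //= _ _.
- by have := can_inj fK (etrans (inc_aut_nadir fA) (esym E)).
- by move=> _; exists h.
Qed.

Lemma inc_aut_copyV f f' x : inc_aut f f' -> exists x', f (copyV x) = copyV x'.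
Proof.
move=> fA; case: (fA) => fK f'K fE.
have xA : inc (f (copyV x)) apex by rewrite -(inc_aut_apex fA) fE.
have xF : inc (f (copyV x)) flagtop by rewrite -(inc_aut_flag fA).2 fE.
case E: (f (copyV x)) xA xF => [||h|h|u|u|||h r|u r] //= _ _.
- by have := can_inj fK (etrans (inc_aut_nadir fA) (esym E)).
- by have := can_inj fK (etrans (inc_aut_flag fA).1 (esym E)).
- have [h' ] := inc_aut_copyH h (inc_aut_sym fA).
  by rewrite -E fK.
- by exists u.
Qed.

(** The shape of an automorphism: it acts separately on each family of points, and
the maps induced on the two copies and on the segment labels are compatible
with incidence in the way that [segment_rigid] expects. *)
Record coordinates (f : point -> point) (phi chi : H -> H)
    (sigma : H -> option H -> option H) (alpha beta : V -> V)
    (tau : V -> option V -> option V) : Prop := Coordinates {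
  coord_nadir : f nadir = nadir;
  coord_flag : f flag = flag;
  coord_apex : f apex = apex;
  coord_flagtop : f flagtop = flagtop;
  coord_baseH : forall h, f (baseH h) = baseH (phi h);
  coord_copyH : forall h, f (copyH h) = copyH (chi h);
  coord_testH : forall h s, f (testH h s) = testH (phi h) (sigma h s);
  coord_baseV : forall v, f (baseV v) = baseV (alpha v);
  coord_copyV : forall v, f (copyV v) = copyV (beta v);
  coord_testV : forall v s, f (testV v s) = testV (alpha v) (tau v s);
  coord_fiber : forall v, q (alpha v) = phi (q v);
  coord_sgH : forall y s x, sgH (phi y) (sigma y s) (chi x) <-> sgH y s x;
  coord_sgV : forall y s x, sgV (alpha y) (tau y s) (beta x) <-> sgV y s x
}.

Lemma inc_aut_coordinates f f' : inc_aut f f' ->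
  exists phi chi sigma alpha beta tau, coordinates f phi chi sigma alpha beta tau.
Proof.
move=> fA; have [fflag fflagtop] := inc_aut_flag fA.
have [phi phiE] := choice (fun h => inc_aut_baseH h fA).
have [chi chiE] := choice (fun h => inc_aut_copyH h fA).
have [sigma sigmaE] := choice (fun p : H * option H => inc_aut_testH p.1 p.2 fA).
have [alpha alphaE] := choice (fun v => inc_aut_baseV v fA).
have [beta betaE] := choice (fun v => inc_aut_copyV v fA).
have [tau tauE] := choice (fun p : V * option V => inc_aut_testV p.1 p.2 fA).
have sigmaE' h s : f (testH h s) = testH (phi h) (sigma (h, s)).
  by rewrite (sigmaE (h, s)) phiE.
have tauE' v s : f (testV v s) = testV (alpha v) (tau (v, s)).
  by rewrite (tauE (v, s)) alphaE.
exists phi, chi, (fun h s => sigma (h, s)), alpha, beta, (fun v s => tau (v, s)).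
split=> //.
- exact: inc_aut_nadir fA.
- exact: inc_aut_apex fA.
- by move=> v; rewrite (inc_aut_baseV_fiber fA (alphaE v) (phiE _)).
- move=> y s x; case: fA => _ _ /(_ (copyH x) (testH y s)); by rewrite chiE sigmaE'.
- move=> y s x; case: fA => _ _ /(_ (copyV x) (testV y s)); by rewrite betaE tauE'.
Qed.

End Rigidity.

End Incidence.

(** * Automorphisms of Alexandrov spaces *)

Section AlexandrovMaps.

Definition monotone_cts (T T' : Type) (le : T -> T -> Prop)
    (le' : T' -> T' -> Prop) (f : T -> T')
    (fle : forall x y, le x y -> le' (f x) (f y)) :
    continuousType (alexandrov le) (alexandrov le') :=
  mkcts (@alexandrov_continuous _ _ le le' f fle).

Section MonotoneAction.
Context (K : groupType) (T : Type) (le : T -> T -> Prop) (F : K -> T -> T).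
Hypotheses (F1 : forall x, F 1 x = x)
  (FM : forall g h x, F (g * h) x = F g (F h x))
  (Fle : forall g x y, le x y -> le (F g x) (F g y)).
Local Notation X := (alexandrov le : Top).

Definition action_cts g : hom X X := monotone_cts (Fle g).

Lemma action_ctsM g h : g * h = 1 -> (action_cts g \c action_cts h)%cat = idm X.
Proof. by move=> gh; apply/continuousEP => x /=; rewrite -[LHS]FM gh F1. Qed.

Definition action_aut g : aut X :=
  Aut (action_ctsM (mulVg g)) (action_ctsM (mulgV g)).

Lemma aut_iso_aut : preorder le ->
  (forall g h, F g =1 F h -> g = h) ->
  (forall f f' : T -> T, cancel f f' -> cancel f' f ->
    (forall x y, le x y -> le (f x) (f y)) ->
    (forall x y, le x y -> le (f' x) (f' y)) -> exists g, f =1 F g) ->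
  aut_iso action_aut.
Proof.
move=> pre Finj Fsurj; split; last first.
  by move=> g h; apply: autm_inj; apply/continuousEP => x /=; exact: FM.
have surj (f : aut X) : exists g, action_aut g = f.
  have /continuousEP fK := autmK f.
  have /continuousEP f'K := autmVK f.
  have mono (p : continuousType (alexandrov le) (alexandrov le)) x y :
      le x y -> le (p x) (p y).
    by apply: (continuous_alexandrov (f := p)) => //; exact: cts_fun.
  pose p : continuousType (alexandrov le) (alexandrov le) := autm f.
  pose p' : continuousType (alexandrov le) (alexandrov le) := autm_inv f.
  have [g fg] := Fsurj p p' fK f'K (mono p) (mono p').
  by exists g; apply: autm_inj; apply/continuousEP => x; rewrite [RHS]fg.
have [p pE] := choice surj.
exists p => // g; apply: Finj => x.
by have /(congr1 (@autm _ _)) /continuousEP /(_ x) := pE (action_aut g).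
Qed.

End MonotoneAction.

Lemma homotopy_rigid_alexandrov (R : realType) (T : Type) (le : T -> T -> Prop) :
  preorder le -> finite_set [set: T] -> monotone_rigid le ->
  homotopy_rigid R (alexandrov le).
Proof.
move=> pre fin rig f fid; apply/continuousEP => x.
by have -> : (f : alexandrov le -> alexandrov le) = id by exact: rigid_homotopy fid.
Qed.

End AlexandrovMaps.

(** * Topology of the incidence poset *)

Section PosetTopology.
Context (H V : Type) (sgH : H -> option H -> H -> Prop) (q : V -> H)
  (sgV : V -> option V -> V -> Prop).
Local Notation le := (le sgH q sgV).
Local Notation X := (alexandrov le).

Lemma finite_option (T : Type) : finite_set [set: T] -> finite_set [set: option T].
Proof.
move=> fT; have -> : [set: option T] = [set None] `|` Some @` setT.
  by apply/seteqP; split=> // -[x|] _; [right; exists x|left].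
by rewrite finite_setU; split; [exact: finite_set1|exact: finite_image].
Qed.

Lemma finite_pair (T U : Type) : finite_set [set: T] -> finite_set [set: U] ->
  finite_set [set: T * U].
Proof. by move=> fT fU; rewrite -setXTT; exact: finite_setX. Qed.

Lemma finite_point : finite_set [set: H] -> finite_set [set: V] ->
  finite_set [set: point H V].
Proof.
move=> fH fV.
have -> : [set: point H V] = [set nadir] `|` [set flag] `|` [set apex] `|`
  [set flagtop] `|` baseH @` setT `|` copyH @` setT `|` baseV @` setT `|`
  copyV @` setT `|` (fun p => testH p.1 p.2) @` setT `|`
  (fun p => testV p.1 p.2) @` setT.
  apply/seteqP; split=> // -[||h|h|v|v|||h s|v s] _.
  - by do 9 left.
  - by do 8 left; right.
  - by do 5 left; right; exists h.
  - by do 4 left; right; exists h.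
  - by do 3 left; right; exists v.
  - by do 2 left; right; exists v.
  - by do 7 left; right.
  - by do 6 left; right.
  - by left; right; exists (h, s).
  - by right; exists (v, s).
have fHo := finite_pair fH (finite_option fH).
have fVo := finite_pair fV (finite_option fV).
rewrite !finite_setU; do ![split]; try exact: finite_set1; exact: finite_image.
Qed.

Lemma connected_point : connected [set: X].
Proof.
apply: (@alexandrov_connected _ le nadir apex); first by right.
by case=> [||h|h|v|v|||h s|v s]; rewrite /le /=; try (by left; right); try (by right; right); left; left.
Qed.

(** A chain has at most one point on each of the two levels. *)
Lemma height_point : has_height X 1.
Proof.
have pre : preorder le by exact: le_preorder.
split.
  exists [fset (nadir : X); (apex : X)]%fset.
    by move=> x y; rewrite !inE => /orP[]/eqP-> /orP[]/eqP->; rewrite !top_leE //;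
      [left; left|left; right|right; right|left; left].
  by rewrite cardfs2; case: eqP.
move=> c chain; pose top (x : X) := `[< inc sgH q sgV nadir x >].
have topI : {in enum_fset c &, injective top}.
  move=> x y xc yc txy.
  have nincE u v : top u = top v -> ~ inc sgH q sgV u v.
    move=> uv /[dup] /inc_nadir nv; move/asboolP: (nv); rewrite -/(top v) -uv.
    by move=> /asboolP nu uv'; have := inc_trans nu uv'.
  have := chain x y xc yc; rewrite !top_leE // => -[[//|xy]|[//|yx]].
    by have := nincE _ _ txy xy.
  by have := nincE _ _ (esym txy) yx.
have uc : uniq (map top (enum_fset c)) by rewrite map_inj_in_uniq // fset_uniq.
by have := uniq_leq_size uc (s2 := [:: true; false]); rewrite size_map; apply => -[].
Qed.

End PosetTopology.

(** * Automorphism groups of the two incidence posets *)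

Section Shift.
Context (H : groupType) (rk : H -> nat) (V : Type) (q : V -> H)
  (sg : V -> option V -> V -> Prop).
Local Notation le := (le (segment rk) q sg).

Definition shift (h : H) (a : V -> V) (x : point H V) : point H V :=
  match x with
  | baseH k => baseH (h * k)
  | copyH k => copyH (h * k)
  | testH k s => testH (h * k) s
  | baseV v => baseV (a v)
  | copyV v => copyV (a v)
  | testV v s => testV (a v) s
  | _ => x
  end.

Lemma shift_le h (a : V -> V) : (forall v, q (a v) = h * q v) ->
  (forall v s x, sg v s x -> sg (a v) s (a x)) ->
  forall x y, le x y -> le (shift h a x) (shift h a y).
Proof.
move=> qa sga x y [->|xy]; [by left|right].
case: x xy => [||k|k|v|v|||k s|v s]; case: y => [||k'|k'|v'|v'|||k' s'|v' s'] //=.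
- by move=> ->.
- by move=> ->; rewrite qa.
- by move=> ks; apply/segmentM.
- by move=> ->.
- exact: sga.
Qed.

End Shift.

Lemma segmentN (K : groupType) (rk : K -> nat) (y x : K) : ~ segment rk y None x.
Proof. by []. Qed.

Lemma segment_refl (K : groupType) (rk : K -> nat) (x : K) :
  exists s, segment rk x (Some s) x.
Proof. by exists 1; rewrite /= mulVg. Qed.

Section Automorphisms.
Context (H : groupType) (rk : H -> nat).
Hypothesis rkI : injective rk.

(** The segment condition on the [H] part determines it up to a translation,
whatever lies over [H]. *)
Lemma inc_aut_shiftH (V : Type) (q : V -> H) (sg : V -> option V -> V -> Prop) f f' :
  (forall x, exists s, sg x (Some s) x) ->
  inc_aut (segment rk) q sg f f' ->
  exists h alpha beta tau, coordinates (segment rk) q sg f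
    ( *%g h) ( *%g h) (fun _ => id) alpha beta tau.
Proof.
move=> sgI fA.
have coord := @inc_aut_coordinates _ _ _ q _ (@segmentN _ rk) (@segment_refl _ rk)
  sgI 1.
have [phi [chi [sigma [alpha [beta [tau c]]]]]] := coord _ _ fA.
have [phi' [chi' [sigma' [alpha' [beta' [tau' c']]]]]] := coord _ _ (inc_aut_sym fA).
case: fA => fK f'K _.
have chiK : cancel chi chi'.
  by move=> x; have := fK (copyH x); rewrite (coord_copyH c) (coord_copyH c') => -[].
have chi'K : cancel chi' chi.
  by move=> x; have := f'K (copyH x); rewrite (coord_copyH c') (coord_copyH c) => -[].
have [h [phiE chiE sigmaE]] := segment_rigid rkI chi'K chiK (coord_sgH c).
have [c1 c2 c3 c4 c5 c6 c7 c8 c9 c10 c11 c12 c13] := c.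
exists h, alpha, beta, tau; split=> // [k|k|k s|v|y s x].
- by rewrite c5 phiE.
- by rewrite c6 chiE.
- by rewrite c7 phiE sigmaE.
- by rewrite c11 phiE.
- exact: segmentM.
Qed.

(** With [V] empty, the incidence poset is the model of the retract. *)
Definition no_test (y : void) (s : option void) (x : void) : Prop := False.

Definition no_fiber (v : void) : H := match v with end.

Lemma inc_aut_shift0 f f' : inc_aut (segment rk) no_fiber no_test f f' ->
  exists h, f =1 shift h id.
Proof.
move=> /inc_aut_shiftH [[]|h [alpha [beta [tau c]]]]; exists h.
have [c1 c2 c3 c4 c5 c6 c7 _ _ _ _ _ _] := c.
by move=> [||k|k|[]|[]|||k s|[]].
Qed.

Context (G : groupType) (rkG : G -> nat) (r : {multiplicative G -> H}).
Hypothesis rkGI : injective rkG.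

(** The [G] part is translated by some [g] and the [H] part by some [h]; the link
between [1] in [G] and [r 1 = 1] in [H] yields [h = r g]. *)
Lemma inc_aut_shift f f' : inc_aut (segment rk) r (segment rkG) f f' ->
  exists g, f =1 shift (r g) ( *%g g).
Proof.
move=> fA.
have sI := @segment_refl _ rkG.
have [h [alpha [beta [tau c]]]] := inc_aut_shiftH sI fA.
have [h' [alpha' [beta' [tau' c']]]] := inc_aut_shiftH sI (inc_aut_sym fA).
case: fA => fK f'K _.
have betaK : cancel beta beta'.
  by move=> x; have := fK (copyV x); rewrite (coord_copyV c) (coord_copyV c') => -[].
have beta'K : cancel beta' beta.
  by move=> x; have := f'K (copyV x); rewrite (coord_copyV c') (coord_copyV c) => -[].
have [g [alphaE betaE tauE]] := segment_rigid rkGI beta'K betaK (coord_sgV c).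
have hE : h = r g.
  have r1 : r 1 = 1 by apply: (@mulgI _ (r 1)); rewrite -gmulfM !mulg1.
  by have := coord_fiber c 1; rewrite alphaE mulg1 r1 mulg1.
have [c1 c2 c3 c4 c5 c6 c7 c8 c9 c10 _ _ _] := c.
exists g => -[||k|k|v|v|||k s|v s] //=; rewrite -?hE //.
- by rewrite c8 alphaE.
- by rewrite c9 betaE.
- by rewrite c10 alphaE tauE.
Qed.

End Automorphisms.

(** * The retraction *)

Section Retraction.
Context (H : groupType) (rk : H -> nat) (G : groupType) (rkG : G -> nat)
  (r : {multiplicative G -> H}).
Local Notation leX := (le (segment rk) r (segment rkG)).
Local Notation leZ := (le (segment rk) (@no_fiber H) no_test).

Definition base_incl (x : point H void) : point H G :=
  match x with
  | nadir => nadir | flag => flag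
  | baseH h => baseH h | copyH h => copyH h
  | baseV v | copyV v | testV v _ => match v with end
  | apex => apex | flagtop => flagtop
  | testH h s => testH h s
  end.

Definition base_proj (x : point H G) : point H void :=
  match x with
  | nadir => nadir | flag => flag
  | baseH h => baseH h | copyH h => copyH h
  | baseV _ => nadir | copyV _ => flag
  | apex => apex | flagtop => flagtop
  | testH h s => testH h s | testV _ _ => apex
  end.

Lemma base_inclK : cancel base_incl base_proj.
Proof. by case=> // -[]. Qed.

Lemma base_incl_le x y : leZ x y -> leX (base_incl x) (base_incl y).
Proof.
move=> [->|xy]; [by left|right]; by case: x xy => [||?|?|[]|[]|||??|[]];
  case: y => [||?|?|[]|[]|||??|[]].
Qed.

(** The collapsed incidences are sent to pairs among [nadir], [flag], [flagtop] and
[apex]; the link from [baseH (q v)] to the tests of [v] becomes the incidence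
of [baseH (q v)] and [apex]. *)
Lemma base_proj_le x y : leX x y -> leZ (base_proj x) (base_proj y).
Proof.
move=> [->|xy]; first by left.
by case: x xy => [||?|?|?|?|||??|??]; case: y => [||?|?|?|?|||??|??] //= xy;
  try (by right); left.
Qed.

Lemma shift_base_incl g x :
  shift (r g) ( *%g g) (base_incl x) = base_incl (shift (r g) id x).
Proof. by case: x => // -[]. Qed.

End Retraction.

(** * Retracts as ranges of idempotents *)

Section Idempotent.
Context (X Z : topologicalType) (p : continuousType X Z) (j : continuousType Z X).
Hypothesis jK : cancel j p.

Definition split_idempotent : continuousType X X := ctscomp j p.
Local Notation rb := split_idempotent.

Lemma split_idempotent_retraction : topological_retraction rb.
Proof. by move=> _ [x _ <-]; rewrite /= jK. Qed.

Lemma retr_inclK : ctscomp (retr rb) (rincl rb) = ctsid (range rb).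
Proof.
apply/continuousEP => y; apply: val_inj => /=.
exact/split_idempotent_retraction/set_mem/valP.
Qed.

(** The range of [j p], with its subspace topology, is homeomorphic to [Z]. *)
Definition range_to : continuousType (range rb) Z := ctscomp p (rincl rb).
Definition range_from : continuousType Z (range rb) := ctscomp (retr rb) j.

Lemma range_fromK : ctscomp range_to range_from = ctsid Z.
Proof. by apply/continuousEP => z; exact: etrans (congr1 p (congr1 j (jK z))) (jK z). Qed.

Lemma range_toK : ctscomp range_from range_to = ctsid (range rb).
Proof.
apply/continuousEP => y; apply: val_inj => /=; rewrite jK.
exact/split_idempotent_retraction/set_mem/valP.
Qed.

Lemma incl_range_from : ctscomp (rincl rb) range_from = j.
Proof. by apply/continuousEP => z; exact: (congr1 j (jK z)). Qed.

Lemma realizes_range (R : realType) (G H : groupType) (r : G -> H)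
    (a : G -> @aut Top X) (b : H -> @aut Top Z) :
  homotopy_rigid R X -> homotopy_rigid R Z ->
  aut_iso a -> aut_iso b ->
  (forall g x, (autm (a g) : continuousType X X) (j x) =
     j ((autm (b (r g)) : continuousType Z Z) x)) ->
  @realizes Top X (range rb) (retr rb) (rincl rb) G H r /\
  @realizes (HTop R) X (range rb) (hpi R (retr rb)) (hpi R (rincl rb)) G H r.
Proof.
move=> rigX rigZ aR bR ab.
have ab' g : ctscomp (autm (a g)) j = ctscomp j (autm (b (r g))).
  by apply/continuousEP => x; exact: ab.
split.
  exact: (@realizes_iso Top X (range rb) Z _ _ j range_to range_from _ _ _ a b
    retr_inclK range_fromK range_toK incl_range_from aR bR ab').
have aR' := aut_iso_haut (R := R) rigX aR.
have bR' := aut_iso_haut (R := R) rigZ bR.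
apply: (@realizes_iso (HTop R) X (range rb) Z _ _ (hpi R j) (hpi R range_to)
  (hpi R range_from) _ _ _ _ _ _ _ _ _ aR' bR') => [||||g] /=; rewrite !hcompE.
- by rewrite retr_inclK.
- by rewrite range_fromK.
- by rewrite range_toK.
- by rewrite incl_range_from.
- by rewrite ab'.
Qed.

End Idempotent.

(** * The realization theorem *)

Section EquivariantOrder.
Context (G H : groupType) (rkG : G -> nat) (rkH : H -> nat)
  (r : {multiplicative G -> H}).
Local Notation leX := (le (segment rkH) r (segment rkG)).
Local Notation leZ := (le (segment rkH) (@no_fiber H) no_test).

Lemma shiftX_le g x y : leX x y ->
  leX (shift (r g) ( *%g g) x) (shift (r g) ( *%g g) y).
Proof.
by apply: shift_le => [v|v s u]; [exact: gmulfM|move/segmentM; exact].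
Qed.

Lemma shiftZ_le h x y : leZ x y -> leZ (shift h id x) (shift h id y).
Proof. by apply: shift_le => // -[]. Qed.

End EquivariantOrder.

Theorem theorem3p1 (R : realType) (n : nat) (G : finGroupType) (H : groupType)
    (r : {multiplicative G -> H}) (oG : #|G| = n) (hr : group_retraction r) :
  exists X : topologicalType,
    (finite_set [set: X] /\ kolmogorov_space X) /\
    connected [set: X] /\
    has_height X 1 /\
    exists rb : continuousType X X,
      topological_retraction rb /\
      @realizes Top X (range rb) (retr rb) (rincl rb) G H r /\
      @realizes (HTop R) X (range rb) (hpi R (retr rb)) (hpi R (rincl rb)) G H r.
Proof.
have [i iK] := hr.
pose rkG (g : G) : nat := enum_rank g.
pose rkH (h : H) : nat := enum_rank (i h).
have rkGI : injective rkG by move=> g h /ord_inj/enum_rank_inj.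
have rkHI : injective rkH.
  by move=> g h /ord_inj/enum_rank_inj/(can_inj iK).
have finG : finite_set [set: G] by exact: finite_finset.
have finH : finite_set [set: H].
  have -> : [set: H] = r @` [set: G].
    by apply/seteqP; split=> // h _; exists (i h).
  exact: finite_image.
have r1 : r 1 = 1 by apply: (@mulgI _ (r 1)); rewrite -gmulfM !mulg1.
pose leX := le (segment rkH) r (segment rkG).
pose leZ := le (segment rkH) (@no_fiber H) no_test.
have preX : preorder leX by exact: le_preorder.
have preZ : preorder leZ by exact: le_preorder.
have finX : finite_set [set: point H G] by exact: finite_point.
have finZ : finite_set [set: point H void].
  by apply: finite_point => //; exact: finite_finset.
have rigX : monotone_rigid leX.
  by apply: monotone_rigid_le => x; exact: segment_refl.
have rigZ : monotone_rigid leZ.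
  by apply: monotone_rigid_le => [x|[]]; exact: segment_refl.
exists (alexandrov leX); split.
  by split=> //; apply: alexandrov_kolmogorov => // x y; exact: le_anti.
split; first exact: connected_point.
split; first exact: height_point.
pose p := monotone_cts (@base_proj_le H rkH G rkG r).
pose j := monotone_cts (@base_incl_le H rkH G rkG r).
have jK : cancel j p by exact: base_inclK.
exists (split_idempotent p j); split; first exact: split_idempotent_retraction.
have FX1 x : shift (r 1) ( *%g 1) x = x :> point H G.
  by case: x => [||k|k|v|v|||k s|v s] //=; rewrite ?r1 mul1g.
have FXM g h x : shift (r (g * h)) ( *%g (g * h)) x =
    shift (r g) ( *%g g) (shift (r h) ( *%g h) x) :> point H G.
  by case: x => [||k|k|v|v|||k s|v s] //=; rewrite ?gmulfM mulgA.
have FZ1 x : shift 1 id x = x :> point H void.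
  by case: x => [||k|k|[]|[]|||k s|[]] //=; rewrite mul1g.
have FZM g h x : shift (g * h) id x = shift g id (shift h id x) :> point H void.
  by case: x => [||k|k|[]|[]|||k s|[]] //=; rewrite mulgA.
pose a := action_aut FX1 FXM (@shiftX_le G H rkG rkH r).
pose b := action_aut FZ1 FZM (@shiftZ_le H rkH).
apply: (@realizes_range _ _ p j jK R G H r a b).
- exact: homotopy_rigid_alexandrov.
- exact: homotopy_rigid_alexandrov.
- apply: aut_iso_aut => // [g h /(_ (baseV 1))[]|f f' fK f'K fle f'le].
    by rewrite !mulg1.
  by apply: (inc_aut_shift rkHI rkGI (f' := f')); exact: le_inc_aut.
- apply: aut_iso_aut => // [g h /(_ (baseH 1))[]|f f' fK f'K fle f'le].
    by rewrite !mulg1.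
  by apply: (inc_aut_shift0 rkHI (f' := f')); exact: le_inc_aut.
- by move=> g x; exact: shift_base_incl.
Qed.
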